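(* Let $i\in\{1,\ldots,n\}$ and let $y_{i1},\ldots,y_{iT}$ be binary random variables whose joint conditional distribution given $\alpha_i$, $X_i=(x_{i1},\ldots,x_{iT})$ and $y_{i0}\in\{0,1\}$ is the quadratic exponential model $$p^*(y_i\mid\alpha_i,X_i,y_{i0})=\frac{\exp\left(y_{i+}\alpha_i+\sum_{t=1}^T y_{it}x_{it}'\beta-0.5\,y_{i*}\gamma+y_{i\times}\gamma\right)}{\sum_{z\in\{0,1\}^T}\exp\left(z_+\alpha_i+\sum_{t=1}^T z_tx_{it}'\beta-0.5\,z_*\gamma+z_\times\gamma\right)},\qquad y_i=(y_{i1},\ldots,y_{iT})\in\{0,1\}^T .$$ Then there are positive functions $g_{it}(z)$, $z\in\{0,1\}$, $t=2,\ldots,T$ (depending also on the parameters $\alpha_i,\beta,\gamma$), such that $g_{it}(z)$ depends on the data only through $x_{it},\ldots,x_{iT}$, such that the conditional logit of $y_{it}$ given $\alpha_i$, $X_i$ and $y_{i0},\ldots,y_{i,t-1}$ is $$\log\frac{p^*(y_{it}=1\mid\alpha_i,X_i,y_{i0},\ldots,y_{i,t-1})}{p^*(y_{it}=0\mid\alpha_i,X_i,y_{i0},\ldots,y_{i,t-1})}=\begin{cases}\alpha_i+x_{it}'\beta+y_{i,t-1}\gamma+\log\dfrac{g_{i,t+1}(1)}{g_{i,t+1}(0)}-0.5\gamma & \text{if } t<T,\\[2mm] \alpha_i+x_{it}'\beta+y_{i,t-1}\gamma & \text{if } t=T,\end{cases}$$ and such that $\log[g_{it}(1)/g_{it}(0)]\approx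 0.5\gamma$ for $t=2,\ldots,T$, where $\approx$ means that the right-hand side is the first-order Taylor expansion of the left-hand side, as a function of $(\alpha_i,\beta,\gamma)$, around $\alpha_i=0$, $\beta=0$, $\gamma=0$. Moreover, under this model: (i) for $t=2,\ldots,T$, $y_{it}$ is conditionally independent of $y_{i0},\ldots,y_{i,t-2}$ given $\alpha_i$, $X_i$, $y_{i0}$ and $y_{i,t-1}$; (ii) for $t=2,\ldots,T-1$, $y_{it}$ is conditionally independent of $y_{i0},\ldots,y_{i,t-2},y_{i,t+2},\ldots,y_{iT}$ given $\alpha_i$, $X_i$, $y_{i0}$, $y_{i,t-1}$ and $y_{i,t+1}$.
   Context: Subjects are indexed by $i=1,\ldots,n$ and time occasions by $t=1,\ldots,T$. For each subject, $y_{it}\in\{0,1\}$ is the response at time $t$, $y_{i0}\in\{0,1\}$ is the (given) initial observation, $x_{it}\in\mathbb{R}^k$ is a vector of covariates, and $X_i=(x_{i1},\ldots,x_{iT})$. The parameters are $\alpha_i\in\mathbb{R}$ (individual-specific), $\beta\in\mathbb{R}^k$ and $\gamma\in\mathbb{R}$; a prime denotes transpose. Notation: $y_{i+}=\sum_{t=1}^T y_{it}$, $y_{i*}=\sum_{t=1}^T y_{i,t-1}=y_{i0}+y_{i+}-y_{iT}$, $y_{i\times}=\sum_{t=1}^T y_{i,t-1}y_{it}$. For a binary vector $z=(z_1,\ldots,z_T)$, the quantities $z_+,z_*,z_\times$ are defined in the same way, with $z_0$ set equal to $y_{i0}$: $z_+=\sum_{t=1}^T z_t$, $z_*=\sum_{t=1}^T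 z_{t-1}$, $z_\times=\sum_{t=1}^T z_{t-1}z_t$. Conditional probabilities written with $p^*$ are those induced by the joint model $p^*(y_i\mid\alpha_i,X_i,y_{i0})$. *)

(* Defs.v *)
From HB Require Import structures.
From mathcomp Require Import all_boot all_order all_algebra.
From mathcomp Require Import all_classical all_reals all_analysis.
Set Implicit Arguments.
Unset Strict Implicit.
Unset Printing Implicit Defensive.
Import Order.TTheory GRing.Theory Num.Theory.
Import numFieldNormedType.Exports.
Local Open Scope classical_set_scope.
Local Open Scope ring_scope.

(* Covariates are functions [x : nat -> 'cV[R]_k]; only [x 1], ..., [x T] are
   ever used. *)

(* [traj y0 z t] is z_t for 0 <= t <= T, with z_0 := y0; the default value of
   [nth] is only reached for t > T. *)
Definition traj (T : nat) (y0 : bool) (z : T.-tuple bool) (t : nat) : bool :=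
  nth false (y0 :: z) t.

Definition plus_stat (T : nat) (z : nat -> bool) : nat :=
  (\sum_(1 <= t < T.+1) z t)%N.

Definition star_stat (T : nat) (z : nat -> bool) : nat :=
  (\sum_(1 <= t < T.+1) z t.-1)%N.

Definition cross_stat (T : nat) (z : nat -> bool) : nat :=
  (\sum_(1 <= t < T.+1) z t.-1 * z t)%N.

Definition dotp (R : realType) (k : nat) (u v : 'cV[R]_k) : R :=
  (u^T *m v) 0 0.

Definition qe_weight (R : realType) (k T : nat) (x : nat -> 'cV[R]_k)
    (alpha : R) (beta : 'cV[R]_k) (gamma : R) (z : nat -> bool) : R :=
  expR ((plus_stat T z)%:R * alpha
        + \sum_(1 <= t < T.+1) (z t)%:R * dotp (x t) beta
        - 2^-1 * (star_stat T z)%:R * gamma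
        + (cross_stat T z)%:R * gamma).

Definition pstar (R : realType) (k T : nat) (x : nat -> 'cV[R]_k) (y0 : bool)
    (alpha : R) (beta : 'cV[R]_k) (gamma : R) (y : T.-tuple bool) : R :=
  qe_weight T x alpha beta gamma (traj y0 y)
  / \sum_(z : T.-tuple bool) qe_weight T x alpha beta gamma (traj y0 z).

Section Events.
Context d (Omega : measurableType d) (R : realType) (P : probability Omega R).
Implicit Types (Y : nat -> {RV P >-> bool}) (A B C : set nat).

Definition agree Y (S : set nat) (v : nat -> bool) : set Omega :=
  [set w | forall s, S s -> Y s w = v s].

Definition condp (E F : set Omega) : R := fine (P (E `&` F)) / fine (P F).

Definition cond_indep Y A B C : Prop :=
  forall a b c : nat -> bool, (0 < P (agree Y C c))%E ->
    condp (agree Y A a `&` agree Y B b) (agree Y C c)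
    = condp (agree Y A a) (agree Y C c) * condp (agree Y B b) (agree Y C c).

(* [P] plays the role of the conditional law given the individual effect, the
   covariates and the initial observation: under it Y_0 = y0 almost surely and
   (Y_1, ..., Y_T) has the quadratic exponential distribution. *)
Definition qe_model (k T : nat) (x : nat -> 'cV[R]_k) (y0 : bool)
    (alpha : R) (beta : 'cV[R]_k) (gamma : R) Y : Prop :=
  P [set w | Y 0%N w = y0] = 1%E /\
  forall y : T.-tuple bool,
    P (agree Y [set t | (1 <= t <= T)%N] (traj y0 y))
    = (pstar x y0 alpha beta gamma y)%:E.

End Events.

Definition taylor1 (R : realType) (V : normedModType R) (f : V -> R) (p : V)
    (h : V -> R) : Prop :=
  differentiable f p /\ forall v : V, h v = f p + 'd f p (v - p).

(* Main.v *)
Require Import Defs.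
From HB Require Import structures.
From mathcomp Require Import all_boot all_order all_algebra.
From mathcomp Require Import all_classical all_reals all_analysis.
From mathcomp Require Import ring zify.
Import Order.TTheory GRing.Theory Num.Theory.
Import numFieldNormedType.Exports.
Local Open Scope classical_set_scope.
Local Open Scope ring_scope.
Set Implicit Arguments.
Unset Strict Implicit.
Unset Printing Implicit Defensive.

(** The exponent of the quadratic exponential model is a sum over [t] of terms
in [y_(t-1)] and [y_t] only, so the joint weight of a trajectory is a product
of transition weights [phi_t(y_(t-1), y_t)], where
[phi_t(a, b) = exp (b (alpha + x_t' beta) - a gamma / 2 + a b gamma)]
([qe_weightE]). The model is thus a finite inhomogeneous Markov chain, and
everything follows from this product form.

Conditional logit. Summing the weight over the future of time [t] leaves the
product of the transition weights up to [t] times a factor [G_t(y_t)] that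
involves the later covariates only ([chain_mass_prefix]). In the odds of [y_t]
given the past all factors before [t] cancel, so the logit is
[ln (phi_t(a, 1) / phi_t(a, 0)) + ln (G_t(1) / G_t(0))] with [a = y_(t-1)], and
the first term is [alpha + x_t' beta + a gamma] ([qe_conditional_logit]). The
functions of the theorem are [g_(t+1)(z) = exp (z gamma / 2) G_t(z)]: the factor
takes back the term [- z gamma / 2] that the transition out of [y_t = z]
contributes to [G_t(z)] when [t < T].

Taylor expansion. By definition
[ln (g_t(1) / g_t(0)) = gamma / 2 + ln (G_(t-1)(1) / G_(t-1)(0))], so the last
term must vanish to first order at the origin. It does, because the model is
centred: the first-order part of [phi_t(a, 0) + phi_t(a, 1)] is
[alpha + x_t' beta - a gamma + a gamma], in which [a] disappears. By induction
the first-order part of [G_t(a)] does not depend on [a] ([is_diff_tail]).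

Conditional independence. Independence of [A] and [B] given [C] amounts to
[P(A B C) P(C) = P(A C) P(B C)]. Each side is a sum over pairs of trajectories
of the product of their weights, and exchanging the coordinates of the two
trajectories off a set [D] of times that contains [A] and avoids [B] maps one
sum to the other. The product of the weights is preserved as soon as every
transition that crosses the boundary of [D] has an endpoint in [C], where the
two trajectories coincide ([chain_mass_separation]). Part (i) takes for [D] the
times from [t] on, and part (ii) takes [D = {t}]. *)

(** * Trajectories as tuples *)

Definition traj_tuple (T : nat) (v : nat -> bool) : T.-tuple bool :=
  [tuple v i.+1 | i < T].

Lemma traj_tupleK (T : nat) (v : nat -> bool) (s : nat) :
  (s <= T)%N -> traj (v 0%N) (traj_tuple T v) s = v s.
Proof.
case: s => [//|s] sT.
have -> : traj (v 0%N) (traj_tuple T v) s.+1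
  = tnth (traj_tuple T v) (Ordinal sT).
  by rewrite (tnth_nth false).
by rewrite tnth_mktuple.
Qed.

Lemma trajK (T : nat) (y0 : bool) (z : T.-tuple bool) :
  traj_tuple T (traj y0 z) = z.
Proof.
by apply/eq_from_tnth => j; rewrite tnth_mktuple (tnth_nth false).
Qed.

Lemma traj_tuple_eq (T : nat) (v v' : nat -> bool) :
  (forall s, (1 <= s <= T)%N -> v s = v' s) -> traj_tuple T v = traj_tuple T v'.
Proof.
move=> vv'; apply/eq_from_tnth => j; rewrite !tnth_mktuple.
by apply: vv'; rewrite /= ltn_ord.
Qed.

(** * Products of transition weights *)

Section Chain.
Variables (R : realType) (T : nat) (y0 : bool).
Variable phi : nat -> bool -> bool -> R.
Implicit Types (z : T.-tuple bool) (u v : nat -> bool).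

Definition chain_weight u : R := \prod_(1 <= s < T.+1) phi s (u s.-1) (u s).

(** The event [Q] is a predicate on trajectories indexed by all of [nat], so
that it can be applied both to [traj y0 z] and to the paths of a process. *)
Definition chain_mass (Q : (nat -> bool) -> Prop) : R :=
  \sum_(z : T.-tuple bool | `[< Q (traj y0 z) >]) chain_weight (traj y0 z).

Lemma eq_chain_weight u v :
  (forall s, (s <= T)%N -> u s = v s) -> chain_weight u = chain_weight v.
Proof.
move=> uv; apply: eq_big_nat => s /andP[s0 sT].
by rewrite !uv // (leq_trans (leq_pred s)).
Qed.

Lemma eq_chain_mass (Q Q' : (nat -> bool) -> Prop) :
  (forall u, u 0%N = y0 -> Q u <-> Q' u) -> chain_mass Q = chain_mass Q'.
Proof.
by move=> QQ'; apply: eq_bigl => z; apply: asbool_equiv_eq; exact: QQ'.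
Qed.

(** Global Markov property of the chain: if every transition between [D] and its
complement has an endpoint in [C], then what happens on [D] and off [D] is
independent given [C]. Stated with products of unnormalised masses, it is an
identity between two sums over pairs of trajectories that agree on [C], and the
bijection [h] below, which exchanges the coordinates off [D], proves it. *)
Lemma chain_mass_separation (D A B C : set nat) (a b c : nat -> bool) :
  (forall s, A s -> D s /\ (s <= T)%N) ->
  (forall s, B s -> ~ D s /\ (s <= T)%N) ->
  (forall s, C s -> (s <= T)%N) ->
  (forall s, (1 <= s <= T)%N -> (D s.-1 <-> D s) \/ C s.-1 \/ C s) ->
  let agr (S : set nat) v u := forall s, S s -> u s = v s in
  chain_mass (fun u => (agr A a u /\ agr B b u) /\ agr C c u)
    * chain_mass (agr C c)
  = chain_mass (fun u => agr A a u /\ agr C c u)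
    * chain_mass (fun u => agr B b u /\ agr C c u).
Proof.
move=> AD BD CT DC agr.
rewrite /chain_mass !big_distrlr /= !pair_big /=.
pose mix u v s := if `[< D s >] then u s else v s.
(* [h] is an involution: the mixture of the two mixtures is the original. *)
pose h (p : T.-tuple bool * T.-tuple bool) :=
  (traj_tuple T (mix (traj y0 p.1) (traj y0 p.2)),
   traj_tuple T (mix (traj y0 p.2) (traj y0 p.1))).
have h1 p s : (s <= T)%N ->
    traj y0 (h p).1 s = mix (traj y0 p.1) (traj y0 p.2) s.
  by move=> sT; rewrite -[RHS](traj_tupleK (T := T)) // /mix /= if_same.
have h2 p s : (s <= T)%N ->
    traj y0 (h p).2 s = mix (traj y0 p.2) (traj y0 p.1) s.
  by move=> sT; rewrite -[RHS](traj_tupleK (T := T)) // /mix /= if_same.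
have hK : involutive h.
  move=> p; rewrite [LHS]surjective_pairing [RHS]surjective_pairing.
  congr (_, _); rewrite -[RHS](trajK y0); apply: traj_tuple_eq => s /andP[_ sT];
    by rewrite /mix h1 // h2 // /mix; case: ifP => ->.
rewrite (reindex_inj (inv_inj hK)) /=.
have agE1 p (S : set nat) v : (forall s, S s -> (s <= T)%N) ->
    agr S v (traj y0 (h p).1) <-> agr S v (mix (traj y0 p.1) (traj y0 p.2)).
  by move=> ST; split=> H s Ss; move: (H s Ss); rewrite h1 // ST.
have agE2 p (S : set nat) v : (forall s, S s -> (s <= T)%N) ->
    agr S v (traj y0 (h p).2) <-> agr S v (mix (traj y0 p.2) (traj y0 p.1)).
  by move=> ST; split=> H s Ss; move: (H s Ss); rewrite h2 // ST.
have mixA u v : agr A a (mix u v) <-> agr A a u.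
  split=> H s As; have := H s As; rewrite /mix; have [Ds _] := AD s As;
    by rewrite asboolT.
have mixB u v : agr B b (mix u v) <-> agr B b v.
  split=> H s Bs; have := H s Bs; rewrite /mix; have [Ds _] := BD s Bs;
    by rewrite asboolF.
have mixC u v : agr C c (mix u v) /\ agr C c (mix v u)
    <-> agr C c u /\ agr C c v.
  split=> -[H H']; split=> s Cs; move: (H s Cs) (H' s Cs); rewrite /mix;
    by case: ifP.
have AT s : A s -> (s <= T)%N by case/AD.
have BT s : B s -> (s <= T)%N by case/BD.
apply: eq_big => [p|p].
  rewrite -!asbool_and; apply: asbool_equiv_eq.
  rewrite -/(h p).
  have := mixC (traj y0 p.1) (traj y0 p.2).
  have := mixA (traj y0 p.1) (traj y0 p.2).
  have := mixB (traj y0 p.1) (traj y0 p.2).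
  by rewrite !(agE1, agE2) //; tauto.
rewrite -!asbool_and => /asboolP.
rewrite -/(h p) !(agE1, agE2) // => -[[_ H] H'].
have [C1 C2] := (mixC _ _).1 (conj H H').
rewrite (eq_chain_weight (h1 p)) (eq_chain_weight (h2 p)).
rewrite /chain_weight -!big_split; apply: eq_big_nat => s sT /=.
have uv r : C r -> traj y0 p.2 r = traj y0 p.1 r by move=> Cr; rewrite C1 // C2.
(* A transition inside [D] or inside its complement moves as a whole; one that
   crosses the boundary has an endpoint where the trajectories agree. *)
rewrite /mix; case: asboolP => Ds'; case: asboolP => Ds //=.
- by case: (DC s sT) => [|[|]Cr]; [tauto|rewrite (uv _ Cr) // mulrC..].
- by case: (DC s sT) => [|[|]Cr]; [tauto|rewrite (uv _ Cr) // mulrC..].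
- by rewrite mulrC.
Qed.

(** Total weight of the [j] transitions that follow time [t], from state [a]. *)
Fixpoint chain_tail (j t : nat) (a : bool) : R :=
  if j is j'.+1 then \sum_(b : bool) phi t.+1 a b * chain_tail j' t.+1 b else 1.

(** Summing out the future one step at a time, from the last time backwards. *)
Lemma chain_mass_prefix (t : nat) v : v 0%N = y0 -> (t <= T)%N ->
  chain_mass (fun u => forall s, (s <= t)%N -> u s = v s)
  = \prod_(1 <= s < t.+1) phi s (v s.-1) (v s) * chain_tail (T - t) t (v t).
Proof.
move=> v0 tT; move: {2}(T - t)%N (erefl (T - t)%N) => j.
elim: j => [|j IH] in t tT v v0 *.
  move=> Tt; have {Tt tT}-> : t = T.
    by apply/eqP; rewrite eqn_leq tT -subn_eq0 Tt.
  rewrite subnn mulr1 /chain_mass (big_pred1 (traj_tuple T v)) => [|z].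
    by apply: eq_chain_weight => s sT; rewrite -v0 traj_tupleK.
  apply/asboolP/eqP => [H|-> s sT]; last by rewrite -v0 traj_tupleK.
  by rewrite -(trajK y0 z); apply: traj_tuple_eq => s /andP[_]; exact: H.
move=> Tt.
have tT' : (t < T)%N by rewrite -subn_gt0 Tt.
have Tt' : (T - t.+1)%N = j by rewrite subnS Tt.
(* Split the trajectories by their value [b] at time [t.+1]; each class is again
   the set of trajectories with a prescribed prefix [w]. *)
rewrite {1}/chain_mass (partition_big (fun z => traj y0 z t.+1) xpredT) //=.
rewrite Tt /= big_distrr /=; apply: eq_bigr => b _.
pose w s := if s == t.+1 then b else v s.
have wv s : (s <= t)%N -> w s = v s.
  by move=> st; rewrite /w ltn_eqF.
have -> : \sum_(z : T.-tuple bool |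
      `[< forall s, (s <= t)%N -> traj y0 z s = v s >] && (traj y0 z t.+1 == b))
      chain_weight (traj y0 z)
    = chain_mass (fun u => forall s, (s <= t.+1)%N -> u s = w s).
  apply: eq_bigl => z; apply/andP/asboolP => [[/asboolP H /eqP Hb] s|H].
    by rewrite leq_eqVlt ltnS /w; case: eqP => [-> //|_ /= /H].
  split; last by rewrite H // /w eqxx.
  by apply/asboolP => s st; rewrite H ?(leqW st) // wv.
have wt : w t.+1 = b by rewrite /w eqxx.
rewrite IH // Tt' big_nat_recr //= wt (wv t) // mulrA.
congr (_ * _ * _); apply: eq_big_nat => s /andP[s0 st].
by rewrite !wv // (leq_trans (leq_pred s)).
Qed.

End Chain.

(** * Events of a process with finitely many binary coordinates *)

Section Law.
Context d (Omega : measurableType d) (R : realType) (P : probability Omega R).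
Implicit Types (Y : nat -> {RV P >-> bool}).

Lemma measurable_agree Y S v : measurable (agree Y S v).
Proof.
have -> : agree Y S v = \bigcap_(s in S) (Y s @^-1` [set v s]) by [].
by apply: bigcap_measurableType => s _; apply: measurable_funPTI.
Qed.

Lemma measure_full_setI (E F : set Omega) : measurable E -> measurable F ->
  P E = 1%E -> P F = P (F `&` E).
Proof.
move=> mE mF PE.
have PEC : P (~` E) = 0%E by rewrite probability_setC // PE subee.
rewrite (measureDI P mF mE) (subset_measure0 (B := ~` E)) ?add0e //.
- exact: measurableD.
- exact: measurableC.
Qed.

(** The probabilities of the cylinders over times [1..T] determine those of all
events up to time [T], since [Y 0] is almost surely [y0]: on the full event
[Y 0 = y0], such an event is a finite disjoint union of cylinders. *)
Lemma trajectory_law (T : nat) (y0 : bool) (p : T.-tuple bool -> R) Y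
    (Q : (nat -> bool) -> Prop) :
  P [set w | Y 0%N w = y0] = 1%E ->
  (forall y : T.-tuple bool,
    P (agree Y [set t | (1 <= t <= T)%N] (traj y0 y)) = (p y)%:E) ->
  (forall u v, (forall s, (s <= T)%N -> u s = v s) -> Q u -> Q v) ->
  let F := [set w | Q (fun s => Y s w)] in
  measurable F ->
  P F = (\sum_(z : T.-tuple bool | `[< Q (traj y0 z) >]) p z)%:E.
Proof.
move=> P0 PY QT F mF.
pose E := [set w | Y 0%N w = y0].
pose cyl (z : T.-tuple bool) := agree Y [set t | (1 <= t <= T)%N] (traj y0 z).
have mE : measurable E by exact: (measurable_funPTI (Y 0%N) (Y := [set y0])).
have mcyl z : measurable (cyl z) by exact: measurable_agree.
pose D := [set z : T.-tuple bool | Q (traj y0 z)].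
have cylY w z : w \in E -> cyl z w ->
    forall s, (s <= T)%N -> Y s w = traj y0 z s.
  by rewrite inE => Ew cw [|s] sT //; apply: cw => /=.
have tD : trivIset D cyl.
  move=> z z' _ _ [w [/= zw z'w]]; rewrite -(trajK y0 z) -(trajK y0 z').
  by apply: traj_tuple_eq => s sT; rewrite -zw // z'w.
have finD : finite_set D by exact: finite_finset.
have FE : F `&` E = (\bigcup_(z in D) cyl z) `&` E.
  apply/seteqP; split=> w [Fw Ew]; split => //.
    have YE s : (s <= T)%N -> Y s w = traj y0 (traj_tuple T (fun s => Y s w)) s.
      by move=> sT; rewrite -[y0]Ew traj_tupleK.
    exists (traj_tuple T (fun s => Y s w)); first exact: QT Fw.
    by move=> s /andP[_ sT]; exact: YE.
  case: Fw => z Dz zw; apply: QT Dz => s sT.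
  by rewrite (cylY w z) ?inE.
rewrite (measure_full_setI mE mF P0) FE -(measure_full_setI mE) //; last first.
  exact: fin_bigcup_measurable.
rewrite measure_fin_bigcup //.
rewrite (eq_fsbigr (fun z => (p z)%:E)); last by move=> z _; exact: PY.
have -> : D = [set` (fun z => `[< Q (traj y0 z) >])].
  by apply/seteqP; split=> z /asboolP.
rewrite -(@bigfs _ _ _ _ (index_enum _)) ?index_enum_uniq ?sumEFin // => z _.
by rewrite mem_index_enum.
Qed.

End Law.

(** * Transition weights of the quadratic exponential model *)

Section Weights.
Variables (R : realType) (k : nat).
Local Notation V := (R * 'cV[R]_k * R)%type.

Definition obs_index (xt : 'cV[R]_k) (theta : V) : R :=
  theta.1.1 + dotp xt theta.1.2.

Definition qe_trans (x : nat -> 'cV[R]_k) (theta : V) (t : nat)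
    (a b : bool) : R :=
  expR (b%:R * obs_index (x t) theta
        + (a%:R * b%:R - 2^-1 * a%:R) * theta.2).

Definition qe_tail x theta := chain_tail (qe_trans x theta).

Lemma qe_tail_gt0 x theta j t a : 0 < qe_tail x theta j t a.
Proof.
elim: j t a => [|j IH] t a; rewrite /qe_tail /= ?ltr01 // big_bool /=.
by rewrite addr_gt0 // mulr_gt0 ?expR_gt0 //; exact: IH.
Qed.

Lemma eq_qe_tail (x x' : nat -> 'cV[R]_k) theta j t a :
  (forall s, (t < s <= t + j)%N -> x s = x' s) ->
  qe_tail x theta j t a = qe_tail x' theta j t a.
Proof.
elim: j t a => [//|j IH] t a xx'; rewrite /qe_tail /=; apply: eq_bigr => b _.
congr (_ * _); first by rewrite /qe_trans xx' // ltnSn addnS ltnS leq_addr.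
by apply: IH => s /andP[ts st]; rewrite xx' // addnS -addSn st ltnW.
Qed.

(** The function [g_t] of the theorem: the weight of all transitions into times
[t..T] from the state [z] at time [t - 1], freed from the term
[- z gamma / 2] that the first of them carries. *)
Definition qe_future (T t : nat) x (theta : V) (z : bool) : R :=
  expR (2^-1 * z%:R * theta.2) * qe_tail x theta (T - t.-1) t.-1 z.

Lemma ln_qe_future_ratio T t x theta :
  ln (qe_future T t x theta true / qe_future T t x theta false)
  = 2^-1 * theta.2 + (ln (qe_tail x theta (T - t.-1) t.-1 true)
                      - ln (qe_tail x theta (T - t.-1) t.-1 false)).
Proof.
rewrite /qe_future mulr1 mulr0 mul0r expR0 mul1r.
by rewrite ln_div ?lnM ?expRK ?addrA // posrE ?mulr_gt0 ?expR_gt0 ?qe_tail_gt0.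
Qed.

End Weights.

(** * First-order expansion at the origin *)

Section Differentials.
Variable R : realType.

Lemma is_diff_linear (U : normedModType R) (f : {linear U -> R}) (p : U) :
  continuous f -> is_diff p f f.
Proof.
by move=> cf; apply: DiffDef; [exact: linear_differentiable|exact: diff_lin].
Qed.

Lemma is_diff_of_derive (f : R -> R) (a l : R) :
  is_derive a 1 f l -> is_diff a f (fun h => h * l).
Proof.
move=> [df fl].
have df' : differentiable f a by apply/derivable1_diffP.
by apply: DiffDef => //; rewrite diff1E // derive1E fl.
Qed.

Lemma is_diff_expR_at0 (U : normedModType R) (f df : U -> R) (p : U) :
  is_diff p f df -> f p = 0 -> is_diff p (fun q => expR (f q)) df.
Proof.
move=> dfp fp.
have dexp := is_diff_comp dfp (is_diff_of_derive (is_derive_expR (f p))).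
apply: (is_diff_eq dexp).
by apply/funext => q /=; rewrite fp expR0 mulr1.
Qed.

End Differentials.

Section Taylor.
Variables (R : realType) (k : nat).
Local Notation V := (R * 'cV[R]_k * R)%type.
Implicit Type x : nat -> 'cV[R]_k.

Lemma is_diff_index (xt : 'cV[R]_k) (p : V) :
  is_diff p (obs_index xt) (obs_index xt).
Proof.
have lin : linear (obs_index xt).
  move=> c u v; rewrite /obs_index /dotp /= mulmxDr -scalemxAr !mxE.
  by rewrite scalerDr addrACA.
pose L : {linear V -> R} :=
  HB.pack (obs_index xt) (GRing.isLinear.Build _ _ _ _ _ lin).
apply: (is_diff_linear (f := L)).
move=> u.
have cvg1 : (fun v : V => v.1) @ u --> u.1 by exact: cvg_fst.
have cvg11 : (fun v : V => v.1.1) @ u --> u.1.1.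
  by apply: (cvg_comp _ _ cvg1); exact: cvg_fst.
have cvg12 : (fun v : V => v.1.2) @ u --> u.1.2.
  by apply: (cvg_comp _ _ cvg1); exact: cvg_snd.
have addc : continuous (fun q : R * R => q.1 + q.2).
  by move=> q; exact: add_continuous.
change ((fun v : V => v.1.1 + (xt^T *m v.1.2) 0 0) @ u
  --> u.1.1 + (xt^T *m u.1.2) 0 0).
apply: cvgD => //; rewrite mxE; under eq_fun do rewrite mxE.
apply: (cvg_big addc) => j _; apply: cvgMl_tmp.
exact: (cvg_comp _ _ cvg12 (@coord_continuous R k 1 j 0 u.1.2)).
Qed.

Lemma is_diff_snd (p : V) : is_diff p (fun q : V => q.2) (fun q : V => q.2).
Proof. by apply: (is_diff_linear (f := snd)) => q; exact: cvg_snd. Qed.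

Lemma is_diff_trans x t a b :
  is_diff ((0, 0, 0) : V) (fun theta => qe_trans x theta t a b)
    (fun theta => b%:R * obs_index (x t) theta
                  + (a%:R * b%:R - 2^-1 * a%:R) * theta.2).
Proof.
apply: is_diff_expR_at0.
  exact: (is_diffD (is_diffZ _ (is_diff_index _ _))
                   (is_diffZ _ (is_diff_snd _))).
by rewrite /obs_index /dotp /= mulmx0 mxE !(addr0, mulr0).
Qed.

Lemma qe_trans0 x t a b : qe_trans x (0, 0, 0) t a b = 1.
Proof.
by rewrite /qe_trans /obs_index /dotp /= mulmx0 mxE !(addr0, mulr0) expR0.
Qed.

Lemma qe_tail0 x j t a : qe_tail x (0, 0, 0) j t a = 2 ^+ j.
Proof.
elim: j t a => [//|j IH] t a; rewrite /qe_tail /= big_bool /=.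
rewrite -!/(qe_tail _ _ _ _ _).
by rewrite !IH !qe_trans0 !mul1r exprS mulr_natl mulr2n.
Qed.

(** The differential [c] does not depend on the state [a]: this is where the
coefficient [1/2] of the centring term matters. Since [qe_trans] and [qe_tail]
are [1] and [2 ^+ j] at the origin, summing over the next state gives
[2 ^+ j] times [obs_index + (a - a / 2 - a / 2) gamma], plus [2 c]. *)
Lemma is_diff_tail x j t : exists c : V -> R, forall a,
  is_diff ((0, 0, 0) : V) (fun theta => qe_tail x theta j t a) c.
Proof.
elim: j t => [|j IH] t; first by exists 0 => a; exact: is_diff_cst.
have [c cP] := IH t.+1.
exists (fun theta => 2 ^+ j * obs_index (x t.+1) theta + 2 * c theta) => a.
have dterm b := is_diffM (is_diff_trans x t.+1 a b) (cP b).
have -> : (fun theta => qe_tail x theta j.+1 t a)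
  = (fun theta => qe_trans x theta t.+1 a true)
    * (fun theta => qe_tail x theta j t.+1 true)
  + (fun theta => qe_trans x theta t.+1 a false)
    * (fun theta => qe_tail x theta j t.+1 false).
  by apply/funext => theta; rewrite /qe_tail /= big_bool.
apply: (is_diff_eq (is_diffD (dterm true) (dterm false))).
apply/funext => theta; rewrite !fctE !qe_trans0 !qe_tail0 /GRing.scale /=.
by field.
Qed.

Lemma taylor1_qe_future T t x :
  taylor1
    (fun theta => ln (qe_future T t x theta true / qe_future T t x theta false))
    (0, 0, 0) (fun theta => 2^-1 * theta.2).
Proof.
set f := (X in taylor1 X).
have [c cP] := is_diff_tail x (T - t.-1) t.-1.
pose lnt a := fun theta => ln (qe_tail x theta (T - t.-1) t.-1 a).
have dln a := is_diff_comp (cP a)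
  (is_diff_of_derive
     (is_derive1_ln (qe_tail_gt0 x (0, 0, 0) (T - t.-1) t.-1 a))).
have df : is_diff ((0, 0, 0) : V) f (fun theta => 2^-1 * theta.2).
  have -> : f = (2^-1 : R) *: (fun q : V => q.2) + (lnt true - lnt false).
    by apply/funext => theta; exact: ln_qe_future_ratio.
  apply: (is_diff_eq (is_diffD (is_diffZ _ (is_diff_snd _))
                               (is_diffB (dln true) (dln false)))).
  (* The logarithms of both tails have the same differential. *)
  by apply/funext => theta; rewrite !fctE /= !qe_tail0 subrr addr0.
split; first exact: ex_diff.
move=> v; rewrite diff_val /f ln_qe_future_ratio !qe_tail0 subrr addr0 /=.
by rewrite mulr0 add0r subr0.
Qed.

End Taylor.

(** * Conditional laws under the model *)

Section Model.
Variables (R : realType) (k T : nat) (x : nat -> 'cV[R]_k) (y0 : bool).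
Variables (alpha : R) (beta : 'cV[R]_k) (gamma : R).
Local Notation theta := (alpha, beta, gamma).
Local Notation phi := (qe_trans x theta).

Lemma qe_weightE u :
  qe_weight T x alpha beta gamma u = chain_weight T phi u.
Proof.
rewrite /chain_weight /qe_trans -expR_sum /qe_weight; congr expR.
rewrite /plus_stat /star_stat /cross_stat !natr_sum.
rewrite -mulrA !big_distrl /= big_distrr /= -big_split /= -sumrB -big_split /=.
apply: eq_big_nat => s _; rewrite /obs_index /= natrM; ring.
Qed.

Definition qe_partition : R :=
  \sum_(z : T.-tuple bool) chain_weight T phi (traj y0 z).

Lemma qe_chain_weight_gt0 u : 0 < chain_weight T phi u.
Proof. by apply: prodr_gt0 => s _; exact: expR_gt0. Qed.

Lemma qe_partition_gt0 : 0 < qe_partition.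
Proof.
rewrite /qe_partition (bigD1 (traj_tuple T xpredT)) //=.
rewrite ltr_wpDr ?qe_chain_weight_gt0 //.
by apply: sumr_ge0 => z _; exact: ltW (qe_chain_weight_gt0 _).
Qed.

Context d (Omega : measurableType d) (P : probability Omega R).
Variable Y : nat -> {RV P >-> bool}.
Hypothesis model : qe_model T x y0 alpha beta gamma Y.

Lemma qe_law (Q : (nat -> bool) -> Prop) :
  (forall u v, (forall s, (s <= T)%N -> u s = v s) -> Q u -> Q v) ->
  let F := [set w | Q (fun s => Y s w)] in
  measurable F -> fine (P F) = chain_mass T y0 phi Q / qe_partition.
Proof.
move=> QT F mF; have [P0 PY] := model.
rewrite (trajectory_law P0 PY QT mF) /= /chain_mass big_distrl /=.
apply: eq_bigr => z _; rewrite /pstar qe_weightE; congr (_ / _).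
by apply: eq_bigr => z' _; rewrite qe_weightE.
Qed.

(** The normalising constant enters both sides of the product form of conditional
independence twice, so the identity between masses is enough. *)
Lemma qe_cond_indep (D A B C : set nat) :
  (forall s, A s -> D s /\ (s <= T)%N) ->
  (forall s, B s -> ~ D s /\ (s <= T)%N) ->
  (forall s, C s -> (s <= T)%N) ->
  (forall s, (1 <= s <= T)%N -> (D s.-1 <-> D s) \/ C s.-1 \/ C s) ->
  cond_indep Y A B C.
Proof.
move=> AD BD CT DC a b c _.
have AT s : A s -> (s <= T)%N by case/AD.
have BT s : B s -> (s <= T)%N by case/BD.
have agr_local (S : set nat) w (u v : nat -> bool) :
    (forall s, S s -> (s <= T)%N) ->
    (forall s, (s <= T)%N -> u s = v s) ->
    (forall s, S s -> u s = w s) -> forall s, S s -> v s = w s.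
  by move=> ST uv H s Ss; rewrite -uv ?H // ST.
have mY S v := measurable_agree Y S v.
have key := chain_mass_separation y0 phi a b c AD BD CT DC.
have eABC := @qe_law (fun u => ((forall s, A s -> u s = a s) /\
  (forall s, B s -> u s = b s)) /\ (forall s, C s -> u s = c s)).
have eAC := @qe_law (fun u => (forall s, A s -> u s = a s) /\
  (forall s, C s -> u s = c s)).
have eBC := @qe_law (fun u => (forall s, B s -> u s = b s) /\
  (forall s, C s -> u s = c s)).
have eC := @qe_law (fun u => forall s, C s -> u s = c s).
rewrite /condp [in LHS]eABC; last 2 first.
- move=> u v uv [[? ?] ?]; do ?split; by apply: (agr_local _ _ _ _ _ uv).
- exact: (measurableI _ _ (measurableI _ _ (mY A a) (mY B b)) (mY C c)).
rewrite eAC; last 2 first.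
- move=> u v uv [? ?]; split; by apply: (agr_local _ _ _ _ _ uv).
- exact: (measurableI _ _ (mY A a) (mY C c)).
rewrite eBC; last 2 first.
- move=> u v uv [? ?]; split; by apply: (agr_local _ _ _ _ _ uv).
- exact: (measurableI _ _ (mY B b) (mY C c)).
rewrite eC; last 2 first.
- by move=> u v uv ?; apply: (agr_local _ _ _ _ _ uv).
- exact: (mY C c).
move: key => /=.
set MC := chain_mass _ _ _ (fun u => forall s, C s -> _).
set MABC := chain_mass _ _ _ _.
set MAC := chain_mass _ _ _ _.
set MBC := chain_mass _ _ _ _ => key.
have Z0 : qe_partition != 0 by rewrite gt_eqF ?qe_partition_gt0.
(* If [C] has mass 0, then all quotients are 0 by convention. *)
have [MC0|MC0] := eqVneq MC 0; first by rewrite MC0 !(mul0r, invr0, mulr0).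
have -> : MABC = MAC * MBC / MC by rewrite -key mulfK.
by field; rewrite MC0 Z0.
Qed.

(** Past and present together form a prefix, whose mass is a product: all its
factors before time [t] cancel in the odds. *)
Lemma qe_conditional_logit (t : nat) (y : T.-tuple bool) : (1 <= t <= T)%N ->
  let past := agree Y [set s | (s < t)%N] (traj y0 y) in
  ln (condp P [set w | Y t w = true] past
      / condp P [set w | Y t w = false] past)
  = alpha + dotp (x t) beta + (traj y0 y t.-1)%:R * gamma
    + (ln (qe_tail x theta (T - t) t true)
       - ln (qe_tail x theta (T - t) t false)).
Proof.
move=> /andP[t0 tT] past; set v := traj y0 y.
pose pre := \prod_(1 <= s < t) phi s (v s.-1) (v s).
have pre0 : 0 < pre by apply: prodr_gt0 => s _; exact: expR_gt0.
have Z0 := qe_partition_gt0.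
have mpast : measurable past by exact: measurable_agree.
have mjoint b : measurable ([set w | Y t w = b] `&` past).
  by apply: measurableI => //; exact: (measurable_funPTI (Y t) (Y := [set b])).
have joint b : fine (P ([set w | Y t w = b] `&` past))
    = pre * (phi t (v t.-1) b * qe_tail x theta (T - t) t b)
      / qe_partition.
  rewrite (@qe_law
    (fun u => u t = b /\ forall s, (s < t)%N -> u s = v s)); last 2 first.
  - move=> u u' uu' [ub uv]; split=> [|s st]; first by rewrite -uu'.
    by rewrite -uu' ?uv // (leq_trans (ltnW st)).
  - exact: mjoint.
  pose w s := if s == t then b else v s.
  have wv s : (s < t)%N -> w s = v s by move=> st; rewrite /w ltn_eqF.
  have wt : w t = b by rewrite /w eqxx.
  rewrite (@eq_chain_mass _ _ _ _ _
    (fun u => forall s, (s <= t)%N -> u s = w s)); last first.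
    move=> u _; split=> [[ub uv] s|H].
      by rewrite leq_eqVlt => /predU1P[->|st]; [rewrite wt | rewrite wv ?uv].
    by split=> [|s st]; rewrite H ?wt ?wv // ltnW.
  rewrite chain_mass_prefix //; last by rewrite wv.
  rewrite wt; congr (_ / _).
  rewrite big_nat_recr //= wt wv ?prednK // -mulrA; congr (_ * _).
  apply: eq_big_nat => s /andP[s0 st].
  by rewrite !wv // (leq_ltn_trans (leq_pred s)).
(* The past is not null, since it contains one of the joint events above. *)
have past_neq0 : fine (P past) != 0.
  rewrite gt_eqF //.
  rewrite (lt_le_trans (_ : 0 < fine (P ([set w | Y t w = true] `&` past)))) //.
    by rewrite joint divr_gt0 // !mulr_gt0 ?expR_gt0 ?qe_tail_gt0.
  apply: fine_le; [exact: fin_num_measure..|].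
  by apply: le_measure; rewrite ?inE // => w [].
rewrite /condp !joint.
have tailp := qe_tail_gt0 x theta (T - t) t.
set g1 := qe_tail _ _ _ _ true; set g0 := qe_tail _ _ _ _ false.
have phip b : 0 < phi t (v t.-1) b by exact: expR_gt0.
have -> : pre * (phi t (v t.-1) true * g1) / qe_partition / fine (P past)
    / (pre * (phi t (v t.-1) false * g0) / qe_partition / fine (P past))
    = (phi t (v t.-1) true / phi t (v t.-1) false) * (g1 / g0).
  field; rewrite past_neq0 !gt_eqF //; exact: tailp.
rewrite lnM ?ln_div ?posrE ?divr_gt0 ?phip ?tailp //.
rewrite /qe_trans !expRK /obs_index /=; congr (_ + _).
by case: (v _) => /=; field.
Qed.

End Model.

Theorem theorem1 (R : realType) (n T k : nat) (i : 'I_n) :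
  (exists g : nat -> (nat -> 'cV[R]_k) -> R * 'cV[R]_k * R -> bool -> R,
    [/\ (forall t x theta z, (2 <= t <= T)%N -> 0 < g t x theta z),
        (forall t x x', (2 <= t <= T)%N ->
           (forall s, (t <= s <= T)%N -> x s = x' s) -> g t x = g t x'),
        (forall (x : 'I_n -> nat -> 'cV[R]_k) (y0 : 'I_n -> bool)
            (alpha : 'I_n -> R) (beta : 'cV[R]_k) (gamma : R)
            (d : measure_display) (Omega : measurableType d)
            (P : probability Omega R) (Y : nat -> {RV P >-> bool}),
          qe_model T (x i) (y0 i) (alpha i) beta gamma Y ->
          forall (t : nat) (y : T.-tuple bool), (1 <= t <= T)%N ->
          let past := agree Y [set s | (s < t)%N] (traj (y0 i) y) in
          ln (condp P [set w | Y t w = true] past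
              / condp P [set w | Y t w = false] past)
          = if (t < T)%N then
              alpha i + dotp (x i t) beta + (traj (y0 i) y t.-1)%:R * gamma
              + ln (g t.+1 (x i) (alpha i, beta, gamma) true
                    / g t.+1 (x i) (alpha i, beta, gamma) false)
              - 2^-1 * gamma
            else
              alpha i + dotp (x i t) beta + (traj (y0 i) y t.-1)%:R * gamma)
      & (forall t x, (2 <= t <= T)%N ->
          taylor1 (fun theta => ln (g t x theta true / g t x theta false))
            (0, 0, 0) (fun theta => 2^-1 * theta.2))]) /\
  (forall (x : 'I_n -> nat -> 'cV[R]_k) (y0 : 'I_n -> bool)
      (alpha : 'I_n -> R) (beta : 'cV[R]_k) (gamma : R)
      (d : measure_display) (Omega : measurableType d)
      (P : probability Omega R) (Y : nat -> {RV P >-> bool}),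
    qe_model T (x i) (y0 i) (alpha i) beta gamma Y ->
    (forall t : nat, (2 <= t <= T)%N ->
       cond_indep Y [set t] [set s | (s <= t - 2)%N] [set 0%N; t.-1]) /\
    (forall t : nat, (2 <= t <= T.-1)%N ->
       cond_indep Y [set t]
         [set s | (s <= t - 2)%N \/ (t + 2 <= s <= T)%N]
         [set 0%N; t.-1; t.+1])).
Proof.
split.
  exists (@qe_future R k T); split.
  - by move=> t x theta z _; rewrite mulr_gt0 ?expR_gt0 ?qe_tail_gt0.
  - move=> t x x' tT xx'; apply/funext => theta; apply/funext => z.
    congr (_ * _); apply: eq_qe_tail => s st; apply: xx'; lia.
  - move=> x y0 alpha beta gamma d Omega P Y model t y tT past.
    rewrite /past (qe_conditional_logit model) //.
    (* At [t = T] nothing is left to sum out and both tails are 1. *)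
    case: ifPn => [ltT|]; first by rewrite ln_qe_future_ratio /=; ring.
    rewrite -leqNgt -subn_eq0 => /eqP ->.
    by rewrite /qe_tail /= subrr addr0.
  - by move=> t x _; exact: taylor1_qe_future.
move=> x y0 alpha beta gamma d Omega P Y model; split=> t tT.
- apply: (qe_cond_indep model (D := [set s | (t <= s)%N])) => s /=.
  + move=> ->; lia.
  + lia.
  + case=> ->; lia.
  + move=> sT; have [->|st] := eqVneq s t; first by right; left; right.
    left; lia.
- apply: (qe_cond_indep model (D := [set t])) => s /=.
  + move=> ->; lia.
  + lia.
  + case=> [[|]|] ->; lia.
  + move=> sT; have [->|st] := eqVneq s t; first by right; left; left; right.
    have [->|st1] := eqVneq s t.+1; first by right; right; right.
    left; lia.
Qed.
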